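(* Let $m\ge 2$ and $h\ge 0$, and let $(G,D)$ be a finite $3$-transposition group of type $2^{\bullet h}{:}\operatorname{Sp}_{2m}(2)$. Then the diagram of $(G,D)$ has size $n=2^{h}(2^{2m}-1)$ and spectrum $$((\,2^{2m-1+h};\ [2^{m-1+h}]^{2^{2m-1}-2^{m-1}-1},\ [-2^{m-1+h}]^{2^{2m-1}+2^{m-1}-1},\ [0]^{\star}\,)).$$
   Context: A $3$-transposition group $(G,D)$ is a group $G$ generated by a conjugacy class $D$ of elements of order $2$ such that $|de|\in\{1,2,3\}$ for all $d,e\in D$. Its diagram is the graph with vertex set $D$ in which $d$ and $e$ are adjacent iff $|de|=3$; its size is $n=|D|$. The spectrum is that of the $(0,1)$-adjacency matrix, written $((k;\dots,[r]^c,\dots))$: first the degree $k$ of the (regular) diagram, counted once, then the remaining eigenvalues, $[r]^c$ meaning $r$ with multiplicity $c$; if listed values coincide, their multiplicities are added, and $[r]^\star$ means that $r$ has whatever further multiplicity (possibly zero) is required for the total multiplicity to be $n$. $\operatorname{Sp}_{2m}(2)$ is the isometry group of a nondegenerate symplectic form $f$ on $\mathbb{F}_2^{2m}$, with $3$-transposition class $E$ the set of transvections $x\mapsto x+f(x,v)v$, $v\ne 0$. $(G,D)$ has type $2^{\bullet h}{:}\operatorname{Sp}_{2m}(2)$ if $G$ has a normal $2$-subgroup $N$ with $|D\cap dN|=2^h$ for all $d\in D$ and $(G/N,DN/N)\cong(\operatorname{Sp}_{2m}(2),E)$. (Whether the extension splits plays no role.) *)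

(* Defs.v *)
From HB Require Import structures.
From mathcomp Require Import all_boot all_order all_fingroup all_algebra.
From mathcomp Require Import all_solvable all_field.

Set Implicit Arguments.
Unset Strict Implicit.
Unset Printing Implicit Defensive.

Import GRing.Theory.

(* A finite group is, as usual, a subgroup G of an ambient finGroupType gT.   *)

Section ThreeTransposition.
Local Open Scope group_scope.
Variable gT : finGroupType.
Implicit Types (G : {group gT}) (D : {set gT}).

Definition three_transposition_group G D : Prop :=
  [/\ <<D>> = G,
      D \in classes G,
      {in D, forall d, #[d] = 2} &
      {in D &, forall d e, #[d * e] \in [:: 1; 2; 3]%N}].

Definition adjacent : rel gT := fun d e => #[d * e] == 3.

Definition diagram_regular D (k : nat) : Prop :=
  {in D, forall d, #|[set e in D | adjacent d e]| = k}.

Definition diagram_adjmx D : 'M[algC]_#|D| :=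
  (\matrix_(i, j) (adjacent (enum_val i) (enum_val j))%:R)%R.

End ThreeTransposition.

Section Spectrum.
Local Open Scope ring_scope.

(* s lists the eigenvalues of A, in any order, with their multiplicities.     *)
Definition spectrum_of (n : nat) (A : 'M[algC]_n) (s : seq algC) : Prop :=
  char_poly A = \prod_(a <- s) ('X - a%:P).

(* The spectrum ((k; s, [r]^star)). The multiplicity c of the starred entry   *)
(* is determined, since both sides of spectrum_of have degree #|D|.           *)
Definition diagram_spectrum_star (gT : finGroupType) (D : {set gT})
    (k : nat) (s : seq algC) (r : algC) : Prop :=
  diagram_regular D k /\
  exists c : nat, spectrum_of (diagram_adjmx D) (k%:R :: s ++ nseq c r).

End Spectrum.

Section Symplectic.
Local Open Scope ring_scope.
Variable m : nat.
Local Notation V := 'rV['F_2]_(2 * m).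
Variable f : {hermitian V for true & idfun}.

(* The linear isometries of f, as permutations of the vectors.                *)
Definition Sp : {set {perm V}} :=
  [set s : {perm V} |
     [forall a : 'F_2, forall u, forall v, s (a *: u + v) == a *: s u + s v]
     && [forall u, forall v, f (s u) (s v) == f u v]].

Lemma Sp_group_set : group_set Sp.
Proof.
apply/group_setP; split.
  rewrite inE; apply/andP; split.
    by do 3 (apply/forallP=> ?); rewrite !perm1.
  by do 2 (apply/forallP=> ?); rewrite !perm1.
move=> s t; rewrite !inE => /andP[/forallP ls /forallP is_].
move=> /andP[/forallP lt_ /forallP it]; apply/andP; split.
  apply/forallP=> a; apply/forallP=> u; apply/forallP=> v.
  have /forallP/(_ u)/forallP/(_ v)/eqP e := ls a.
  have /forallP/(_ (s u))/forallP/(_ (s v))/eqP e' := lt_ a.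
  by rewrite !permM e e'.
apply/forallP=> u; apply/forallP=> v.
have /forallP/(_ v)/eqP e := is_ u.
have /forallP/(_ (s v))/eqP e' := it (s u).
by rewrite !permM e' e.
Qed.

Canonical Sp_group := Group Sp_group_set.

Definition transvections : {set {perm V}} :=
  [set s : {perm V} |
     [exists v : V, (v != 0) && [forall x, s x == x + f x v *: v]]].

End Symplectic.

Section Type2Sp.
Local Open Scope group_scope.

(* In characteristic 2, is_psymplectic includes f x x = 0 for all x, which    *)
(* skew-symmetry alone does not give. Any such f may be used: over F_2 they   *)
(* are all equivalent.                                                        *)
Definition type_2h_Sp (gT : finGroupType) (G : {group gT}) (D : {set gT})
    (h m : nat) : Prop :=
  exists N : {group gT},
    [/\ N <| G,
        2.-group N,
        {in D, forall d, #|D :&: (d *: N)| = (2 ^ h)%N} &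
        exists2 f : {hermitian 'rV['F_2]_(2 * m) for true & idfun}%R,
          is_psymplectic f &
          exists2 phi : {morphism G / N >-> {perm 'rV['F_2]_(2 * m)}},
            isom (G / N) (Sp f) phi & phi @* (D / N) = transvections f].

End Type2Sp.

(* Main.v *)
(* Sending d in D to the vector v_d of the transvection that d induces makes D
   a 2^h-fold cover of the nonzero vectors. As N is a 2-group, |de| = 3 exactly
   when f(v_d, v_e) = 1. Hence the adjacency matrix is P B P^T, where B(v, w) =
   [f(v, w) = 1] on all vectors and P^T P = 2^h on the nonzero ones, and so it
   has the nonzero spectrum of 2^h B. Finally B = (J - H) / 2 with J the all-one
   matrix of rank one and H(v, w) = (-1)^f(v, w), which satisfies H^2 = 4^m and
   tr H = 4^m: this gives the spectrum of H, and the matrix determinant lemma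
   that of B. *)

Require Import Defs.
From mathcomp Require Import all_boot all_order all_fingroup all_algebra.
From mathcomp Require Import all_solvable all_field.
From mathcomp Require Import ring zify.

Set Implicit Arguments.
Unset Strict Implicit.
Unset Printing Implicit Defensive.

Import Order.TTheory GRing.Theory Num.Theory.

Local Open Scope ring_scope.

(** * Characteristic polynomials of products, of square roots of scalars and of rank-one
    perturbations *)

(** The two Schur complements of [K]: a product on the right clears the block [B]; a product on the
    left clears it too, at the cost of a factor [s ^+ n], which replaces division by [s]. *)
Lemma det_sub_mulmxC (R : comNzRingType) m n (s : R) (A : 'M_(m, n))
    (B : 'M_(n, m)) :
  s ^+ n * \det (s%:M - A *m B) = s ^+ m * \det (s%:M - B *m A).
Proof.
pose K := block_mx s%:M A B 1%:M.
have detK : \det K = \det (s%:M - A *m B).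
  have : K *m block_mx 1%:M 0 (- B) 1%:M = block_mx (s%:M - A *m B) A 0 1%:M.
    by rewrite mulmx_block !mulmx1 !mulmx0 !mul1mx !add0r mulmxN subrr.
  move/(congr1 determinant).
  by rewrite det_mulmx det_lblock det_ublock !det_scalar !expr1n !mulr1.
have : block_mx 1%:M 0 (- B) s%:M *m K
    = block_mx s%:M A 0 (s%:M - B *m A).
  rewrite mulmx_block !mul1mx !mul0mx !addr0 !mulNmx mulmx1.
  by rewrite [_%:M *m B]mul_scalar_mx mul_mx_scalar addNr addrC.
move/(congr1 determinant).
by rewrite det_mulmx det_lblock det_ublock !det_scalar expr1n mul1r detK.
Qed.

Lemma char_poly_mulmxC (R : comNzRingType) m n (A : 'M[R]_(m, n))
    (B : 'M_(n, m)) :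
  'X^n * char_poly (A *m B) = 'X^m * char_poly (B *m A).
Proof. by rewrite /char_poly /char_poly_mx !map_mxM det_sub_mulmxC. Qed.

(** [M'] stands for [s] times the inverse of [M], so nothing is inverted over a polynomial ring. As
    [(M - u *m v) *m M'] is [s%:M - u *m (v *m M')], [det_sub_mulmxC] applies, and [\det M']
    cancels. *)
Lemma det_sub_rank1 (R : idomainType) n (M M' : 'M[R]_n) (s : R) (u : 'cV_n)
    (v : 'rV_n) :
  M *m M' = s%:M -> s != 0 ->
  s * \det (M - u *m v) = \det M * (s - (v *m M' *m u) 0 0).
Proof.
move=> MM' s0.
have s0n : s ^+ n != 0 by rewrite expf_neq0.
have dMM' : \det M * \det M' = s ^+ n by rewrite -det_mulmx MM' det_scalar.
have M'0 : \det M' != 0.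
  by apply: contra_neq s0n => M'0; rewrite -dMM' M'0 mulr0.
apply: (mulIf M'0); apply: (mulIf (oner_neq0 R)); rewrite !mulr1.
have := det_sub_mulmxC s u (v *m M').
rewrite expr1 mulmxA -MM' -mulmxBl det_mulmx mulrA => ->.
by rewrite -dMM' det_mx11 !mxE eqxx mulr1n mulrAC.
Qed.

(* The trace and the size give the multiplicities of the two eigenvalues. *)
Lemma char_poly_sqr_scalar (C : numClosedFieldType) n (M : 'M[C]_n) (r : C)
    (a b : nat) :
  M *m M = (r ^+ 2)%:M -> r != 0 -> n = (a + b)%N ->
  \tr M = (a%:R - b%:R) * r ->
  char_poly M = ('X - r%:P) ^+ a * ('X + r%:P) ^+ b.
Proof.
move=> MM r0 Dn trM.
have [s Ds] := closed_field_poly_normal (char_poly M).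
rewrite (monicP (char_poly_monic M)) scale1r in Ds.
have szs : size s = n.
  by apply: succn_inj; rewrite -(size_char_poly M) Ds size_prod_XsubC.
have s_pm z : z \in s -> z = r \/ z = - r.
  move=> sz; have: root (char_poly M) z by rewrite Ds root_prod_XsubC.
  rewrite -eigenvalue_root_char => /eigenvalueP[v vM v0].
  have: (z ^+ 2 - r ^+ 2) *: v = 0.
    apply/eqP; rewrite scalerBl subr_eq0 expr2 -scalerA -vM scalemxAl -vM.
    by rewrite -mulmxA MM mul_mx_scalar.
  move/eqP; rewrite scaler_eq0 (negPf v0) orbF subr_eq0 eqf_sqr.
  by case/orP=> /eqP; [left | right].
have sumprod (t : seq C) : (forall z, z \in t -> z = r \/ z = - r) ->
    exists2 ab, size t = (ab.1 + ab.2)%N &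
      \sum_(z <- t) z = (ab.1%:R - ab.2%:R) * r /\
      \prod_(z <- t) ('X - z%:P) = ('X - r%:P) ^+ ab.1 * ('X + r%:P) ^+ ab.2.
  elim: t => [|z t IHt] t_pm.
    exists (0%N, 0%N); rewrite ?big_nil //=.
    by rewrite subrr mul0r !expr0 mulr1.
  have [|[a' b']/= -> [IHs IHp]] := IHt.
    by move=> y ty; apply: t_pm; rewrite inE ty orbT.
  rewrite !big_cons IHs IHp.
  have [->|->] := t_pm z (mem_head z t).
    exists (a'.+1, b') => //=; split; last by rewrite exprS mulrA.
    by rewrite -(natr1 a'); ring.
  exists (a', b'.+1); rewrite ?addnS //=; split.
    by rewrite -(natr1 b'); ring.
  by rewrite rmorphN opprK exprS; ring.
have [[a' b']/= Dab [sums prods]] := sumprod s s_pm.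
have sumtr : \sum_(z <- s) z = \tr M.
  have [n0|n_gt0] := posnP n.
    case: (s) (etrans szs n0) => // _; rewrite big_nil /mxtrace big1 // => i _.
    by have := ltn_ord i; rewrite {2}n0.
  apply: oppr_inj; rewrite -(char_poly_trace _ n_gt0) Ds -szs.
  by rewrite coefPn_prod_XsubC // szs -lt0n.
(* Dividing by [r] gives a' - b' = a - b, written with sums so that it descends to natural numbers.
   With a' + b' = a + b it determines both. *)
have Eab : (a' + b)%:R = (a + b')%:R :> C.
  have /(mulIf r0) := etrans (esym sums) (etrans sumtr trM).
  move/eqP; rewrite -subr_eq0 !natrD => /eqP e.
  by apply/eqP; rewrite -subr_eq0 -e; apply/eqP; ring.
move/eqP: Eab; rewrite eqr_nat => /eqP Eab.
have [-> ->] : a = a' /\ b = b' by move: Dab; rewrite szs Dn; lia.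
by rewrite Ds prods.
Qed.

(* Adding the rank-one [u *m v] to [- N] trades one pair of eigenvalues
   [r], [- r] for [k], [0]. *)
Lemma char_poly_rank1_sub (R : idomainType) n (N : 'M[R]_n) (u : 'cV_n)
    (v : 'rV_n) (k r : R) :
  N *m N = (r ^+ 2)%:M -> v *m u = k%:M -> v *m N *m u = (r ^+ 2)%:M ->
  ('X - r%:P) * ('X + r%:P) * char_poly (u *m v - N)
    = char_poly (- N) * ('X * ('X - k%:P)).
Proof.
move=> NN vu vNu; pose P := map_mx (@polyC R) (m := n) (n := n).
have PNN : P N *m P N = (r%:P ^+ 2)%:M.
  by rewrite /P -map_mxM NN map_scalar_mx /= rmorphXn.
(* These are 'X + N and 'X - N, whose product 'X^2 - r^2 is scalar. *)
pose M := char_poly_mx (- N); pose M' := char_poly_mx N.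
have ME : M = 'X%:M + P N by rewrite /M /char_poly_mx map_mxN opprK.
have MM' : M *m M' = (('X - r%:P) * ('X + r%:P))%:M.
  rewrite ME /M' /char_poly_mx -/(P N) mulmxDl !mulmxBr PNN.
  rewrite (scalar_mxC _ (P N)) addrA subrK -scalar_mxM -raddfB /=.
  by congr _%:M; ring.
have s0 : ('X - r%:P) * ('X + r%:P) != 0.
  by rewrite mulf_neq0 // -size_poly_eq0 ?size_XaddC ?size_XsubC.
have -> : char_poly (u *m v - N) = \det (M - map_mx polyC u *m map_mx polyC v).
  rewrite /char_poly /char_poly_mx ME /P map_mxB map_mxM; congr (\det _).
  by rewrite opprB addrA.
(* Here v M' u = k 'X - r^2, so the last factor is ('X^2 - r^2) - (k 'X - r^2) = 'X ('X - k). *)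
rewrite (det_sub_rank1 _ _ MM' s0); congr (_ * _).
rewrite /M' /char_poly_mx mulmxBr mul_mx_scalar mulmxBl -scalemxAl -!map_mxM.
rewrite vu vNu !map_scalar_mx !mxE !eqxx !mulr1n /= rmorphXn /=; ring.
Qed.

(** * Symplectic forms over F_2 and their sign sums *)

(** The nontrivial additive character of F_2, in the form that makes H = J - 2 B hold entrywise. *)
Definition signF2 (a : 'F_2) : algC := 1 - 2 * (a != 0)%:R.

Lemma F2P (a : 'F_2) : a = 0 \/ a = 1.
Proof. by case: a => [[|[|//]] lt_a]; [left | right]; apply: val_inj. Qed.

Lemma signF2D a b : signF2 (a + b) = signF2 a * signF2 b.
Proof.
rewrite /signF2; case: (F2P a) => ->; case: (F2P b) => -> /=;
  rewrite ?addr0 ?add0r ?eqxx ?oner_eq0 /=; ring.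
Qed.

(** Over F_2 additivity is linearity, and 1 is the only nonzero value, so a bare additive group
    suffices as domain. *)
Definition symplectic_F2 (V : finZmodType) (g : V -> V -> 'F_2) : Prop :=
  [/\ forall u, {morph g u : v w / v + w}, forall u v, g u v = g v u,
      forall u, g u u = 0 & forall u, u != 0 -> exists w, g u w = 1].

Lemma psymplectic_F2 m (f : {hermitian 'rV['F_2]_(2 * m) for true & idfun}) :
  is_psymplectic f -> symplectic_F2 (fun u v => f u v).
Proof.
move=> [/eqP rad0 _ alt]; split=> [u v w|u v|u|u u0].
- exact: linearDr.
- rewrite hermC expr1 /=; case: (F2P (f v u)) => ->; first by rewrite mulr0.
  by rewrite mulr1; apply: val_inj.
- by apply: alt; apply: pchar_Fp.
have : u \notin orthov f fullv by rewrite rad0 memv0.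
by case/mem_orthovPn => w _ fuw; exists w; case: (F2P (f u w)) fuw => // ->.
Qed.

(** If u is nonzero, translation by some w with g u w = 1 flips every sign, so the sum equals its
    opposite. *)
Lemma sum_signF2 (V : finZmodType) (g : V -> V -> 'F_2) u :
  symplectic_F2 g -> \sum_v signF2 (g u v) = #|V|%:R * (u == 0)%:R.
Proof.
case=> gD gC _ g1; have [->|u0] := eqVneq u 0; last first.
  have [w guw] := g1 u u0.
  suff: \sum_v signF2 (g u v) = - \sum_v signF2 (g u v).
    by move/eqP; rewrite -addr_eq0 -mulr2n mulrn_eq0 /= mulr0 => /eqP.
  rewrite {1}(reindex_inj (addIr w)) -sumrN; apply: eq_bigr => v _.
  by rewrite gD signF2D guw /signF2 oner_eq0 /=; ring.
transitivity (\sum_(v : V) (1 : algC)).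
  apply: eq_bigr => v _; suff -> : g 0 v = 0 by rewrite /signF2 eqxx /=; ring.
  by apply: (addrI (g v 0)); rewrite addr0 (gC 0 v) -gD addr0.
by rewrite sumr_const mulr1.
Qed.

Lemma sum_signF2_mul (V : finZmodType) (g : V -> V -> 'F_2) (u w : V) :
  symplectic_F2 g ->
  \sum_v signF2 (g u v) * signF2 (g v w) = #|V|%:R * (u + w == 0)%:R.
Proof.
move=> gS; rewrite -(sum_signF2 (u + w) gS); case: gS => gD gC _ _.
by apply: eq_bigr => v _; rewrite -signF2D (gC u) -gD gC.
Qed.

(** Nondegeneracy forces exponent 2: g x (w + w) is twice an element of F_2 for every x, hence w + w
    = 0. *)
Lemma symplectic_F2_addr_eq0 (V : finZmodType) (g : V -> V -> 'F_2) (u w : V) :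
  symplectic_F2 g -> (u + w == 0) = (u == w).
Proof.
case=> gD gC _ g1.
suff ww : w + w = 0 by rewrite -(inj_eq (addIr w) u) ww.
apply/eqP; case: (boolP (w + w == 0)) => // /g1[x].
rewrite gC gD; case: (F2P (g x w)) => -> e; move/(congr1 val): e => //.
Qed.

(** * Spectrum of the matrix of a symplectic form *)

Definition form_mx (V : finType) (g : V -> V -> 'F_2) : 'M[algC]_#|V| :=
  \matrix_(i, j) (g (enum_val i) (enum_val j) != 0)%:R.

Lemma sum_enum_val (T : finType) (F : T -> algC) :
  \sum_(i < #|T|) F (enum_val i) = \sum_x F x.
Proof. by rewrite (big_enum_val (A := T)). Qed.

(* Written as [u *m v - N], where [N] is a multiple of the matrix of signs: its
   square is scalar because distinct rows are orthogonal, and its trace is known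
   because the form is alternating. *)
Lemma char_poly_form_mx (V : finZmodType) (g : V -> V -> 'F_2) m (c : algC) :
  symplectic_F2 g -> #|V| = (2 ^ (2 * m))%N -> (0 < m)%N -> c != 0 ->
  let k := c * (2 ^ (2 * m - 1))%:R in
  let r := c * (2 ^ (m - 1))%:R in
  char_poly (c *: form_mx g) =
    'X * ('X - k%:P)
    * ('X - r%:P) ^+ (2 ^ (2 * m - 1) - 2 ^ (m - 1) - 1)
    * ('X + r%:P) ^+ (2 ^ (2 * m - 1) + 2 ^ (m - 1) - 1).
Proof.
move=> gS cardV m_gt0 c0 k r.
pose p := (2 ^ (m - 1))%N.
have pE : (2 ^ m = 2 * p)%N by rewrite /p -expnS; congr (_ ^ _)%N; lia.
have qE : (2 ^ (2 * m) = 4 * p ^ 2)%N.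
  by rewrite mulnC expnM pE expnMn.
have hE : (2 ^ (2 * m - 1) = 2 * p ^ 2)%N.
  apply/eqP; rewrite -(eqn_pmul2l (isT : 0 < 2)%N) -expnS mulnA -qE.
  by apply/eqP; congr (_ ^ _)%N; lia.
have p_gt0 : (0 < p)%N by rewrite expn_gt0.
(* From c B = (c / 2) (J - H): [u *m v] will be t J and [N] is t H. *)
pose t := c / 2.
pose N : 'M[algC]_#|V| :=
  \matrix_(i, j) (t * signF2 (g (enum_val i) (enum_val j))).
pose u : 'cV[algC]_#|V| := const_mx t; pose v : 'rV[algC]_#|V| := const_mx 1.
have cE : c = 2 * t by rewrite /t mulrCA divff ?mulr1 // pnatr_eq0.
have kE : k = t * #|V|%:R.
  by rewrite cardV qE /k hE cE !natrM; ring.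
have rE : r ^+ 2 = t ^+ 2 * #|V|%:R.
  by rewrite cardV qE /r -/p cE !natrM; ring.
have r0 : r != 0 by rewrite mulf_neq0 // pnatr_eq0 -lt0n.
have NN : N *m N = (r ^+ 2)%:M.
  apply/matrixP=> i j; rewrite !mxE.
  transitivity (t ^+ 2 * \sum_x signF2 (g (enum_val i) x)
                         * signF2 (g x (enum_val j))).
    rewrite -[in RHS]sum_enum_val mulr_sumr; apply: eq_bigr => l _.
    by rewrite !mxE; ring.
  rewrite (sum_signF2_mul _ _ gS) (symplectic_F2_addr_eq0 _ _ gS).
  by rewrite (inj_eq enum_val_inj) mulrA -rE mulr_natr.
have vu : v *m u = k%:M.
  apply/matrixP=> i j; rewrite !ord1 !mxE eqxx mulr1n kE.
  transitivity (\sum_(i < #|V|) t).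
    by apply: eq_bigr => l _; rewrite !mxE mul1r.
  by rewrite sumr_const card_ord mulr_natr.
(* Among the row sums of signs only that of the zero vector survives. *)
have vNu : v *m N *m u = (r ^+ 2)%:M.
  apply/matrixP=> i j; rewrite !ord1 -mulmxA !mxE eqxx mulr1n rE.
  transitivity (\sum_x t ^+ 2 * (#|V|%:R * (x == 0 :> V)%:R)).
    rewrite -[in RHS]sum_enum_val; apply: eq_bigr => l _; rewrite !mxE mul1r.
    rewrite -(sum_signF2 _ gS) mulr_sumr -[in RHS]sum_enum_val; apply: eq_bigr => l' _.
    by rewrite !mxE; ring.
  rewrite (bigD1 0) //= eqxx mulr1 big1 ?addr0 // => x /negPf->.
  by rewrite !mulr0.
(* The diagonal signs are all 1, so the trace is -4 t p^2; with r = 2 t p this is -2 p r, whence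
   multiplicities differing by 2 p. *)
have trN : \tr (- N) = ((2 * p ^ 2 - p)%:R - (2 * p ^ 2 + p)%:R) * r.
  rewrite linearN /= /mxtrace.
  transitivity (- \sum_(i < #|V|) t).
    congr (- _); apply: eq_bigr => l _; case: gS => _ _ g0 _.
    by rewrite mxE g0 /signF2 eqxx mulr0 subr0 mulr1.
  have lp : (p <= 2 * p ^ 2)%N by nia.
  rewrite sumr_const card_ord cardV qE -[t *+ _]mulr_natr (natrB _ lp).
  by rewrite natrD /r -/p cE !natrM; ring.
have charN : char_poly (- N)
    = ('X - r%:P) ^+ (2 * p ^ 2 - p) * ('X + r%:P) ^+ (2 * p ^ 2 + p).
  apply: char_poly_sqr_scalar => //; first by rewrite mulNmx mulmxN opprK.
  by rewrite cardV qE; nia.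
have cB : c *: form_mx g = u *m v - N.
  apply/matrixP=> i j; rewrite !mxE big_ord1 !mxE /signF2 cE; ring.
have := char_poly_rank1_sub NN vu vNu; rewrite -cB charN hE -/p.
(* One eigenvalue r and one -r are traded for k and 0: hence the [- 1] in both exponents. Successors
   expose the pair to cancel. *)
have -> : (2 * p ^ 2 - p = (2 * p ^ 2 - p - 1).+1)%N by nia.
have -> : (2 * p ^ 2 + p = (2 * p ^ 2 + p - 1).+1)%N by nia.
rewrite !subn1 /= => E.
have s0 : ('X - r%:P) * ('X + r%:P) != 0.
  by rewrite mulf_neq0 // -size_poly_eq0 ?size_XaddC ?size_XsubC.
by apply: (mulfI s0); rewrite E !exprS; ring.
Qed.

(** * Pulling the form back along a map with constant fibres *)

Lemma card_set_fibers (T V : finType) (D : {set T}) (pi : T -> V) (Q : pred V)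
    c :
  (forall w, Q w -> #|[set d in D | pi d == w]| = c) ->
  #|[set d in D | Q (pi d)]| = (c * #|[pred w | Q w]|)%N.
Proof.
move=> fibc; rewrite -sum1_card (partition_big pi Q) /=; last first.
  by move=> d; rewrite inE => /andP[].
rewrite mulnC -sum_nat_const; apply: eq_bigr => w Qw.
rewrite -(fibc w Qw) -sum1_card; apply: eq_bigl => d; rewrite !inE.
by case: eqP => [->|_]; rewrite ?andbF // Qw andbT.
Qed.

(** The signs in a nonzero row sum to 0, and also to #|V| minus twice the count. *)
Lemma card_form_neq0 (V : finZmodType) (g : V -> V -> 'F_2) (u : V) :
  symplectic_F2 g -> u != 0 -> (2 * #|[pred w | g u w != 0%R]| = #|V|)%N.
Proof.
move=> gS u0; have := sum_signF2 u gS; rewrite (negPf u0) mulr0 /signF2.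
rewrite sumrB -mulr_sumr sumr_const -natr_sum => /eqP.
rewrite subr_eq0 -natrM eqr_nat => /eqP->; congr (_ * _)%N.
by rewrite -big_mkcond sum1_card.
Qed.

Definition pullback_mx (T : finType) (V : finType) (D : {set T})
    (g : V -> V -> 'F_2) (pi : T -> V) : 'M[algC]_#|D| :=
  \matrix_(i, j) (g (pi (enum_val i)) (pi (enum_val j)) != 0)%:R.

(** With P the incidence matrix of [pi], the pullback is P (B P^T), to be compared with (B P^T) P.
    P^T P is c times the identity except for a zero entry at the zero vector, where B has a zero
    column anyway. *)
Lemma char_poly_pullback_mx (T : finType) (V : finZmodType)
    (g : V -> V -> 'F_2) (D : {set T}) (pi : T -> V) c :
  symplectic_F2 g -> {in D, forall d, pi d != 0} ->
  (forall w, w != 0 -> #|[set d in D | pi d == w]| = c) ->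
  'X^#|V| * char_poly (pullback_mx D g pi)
    = 'X^#|D| * char_poly (c%:R *: form_mx g).
Proof.
move=> [gD _ _ _] pi0 fibc.
have g0 u : g u 0 = 0 by apply: (addrI (g u 0)); rewrite -gD !addr0.
pose P : 'M[algC]_(#|D|, #|V|) :=
  \matrix_(i, x) (pi (enum_val i) == enum_val x)%:R.
have mulP (F : V -> algC) i : \sum_x F (enum_val x) * P i x = F (pi (enum_val i)).
  transitivity (\sum_x F x * (pi (enum_val i) == x)%:R).
    by rewrite -[RHS]sum_enum_val; apply: eq_bigr => x _; rewrite mxE.
  rewrite (bigD1 (pi (enum_val i))) //= eqxx mulr1 big1 ?addr0 // => x.
  by rewrite eq_sym => /negPf->; rewrite mulr0.
have -> : pullback_mx D g pi = P *m (form_mx g *m P^T).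
  apply/matrixP=> i j; rewrite !mxE.
  rewrite -(mulP (fun x => (g x (pi (enum_val j)) != 0)%:R)).
  apply: eq_bigr => x _; rewrite mulrC; congr (_ * _); rewrite mxE.
  rewrite -(mulP (fun y => (g (enum_val x) y != 0)%:R)).
  by apply: eq_bigr => y _; rewrite !mxE.
rewrite char_poly_mulmxC; congr (_ * char_poly _).
apply/matrixP=> x y; rewrite -mulmxA !mxE.
transitivity (\sum_z (g (enum_val x) (enum_val z) != 0)%:R
                * (c%:R * (enum_val z != 0 :> V)%:R * (z == y)%:R) : algC).
  apply: eq_bigr => z _; rewrite !mxE; congr (_ * _).
  transitivity (\sum_(d in D) (pi d == enum_val z)%:R
                               * (pi d == enum_val y)%:R : algC).
    by rewrite [RHS]big_enum_val; apply: eq_bigr => i _; rewrite !mxE.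
  have [<-|zy] := eqVneq z y; last first.
    rewrite mulr0 big1 // => d _.
    have [->|_] := eqVneq (pi d); last exact: mul0r.
    by rewrite (inj_eq enum_val_inj) (negPf zy) mulr0.
  rewrite mulr1; have [->|z0] := eqVneq (enum_val z) 0.
    by rewrite mulr0 big1 // => d /pi0/negPf->; rewrite mul0r.
  rewrite mulr1 -(fibc _ z0) -sum1_card natr_sum big_mkcond [RHS]big_mkcond /=.
  apply: eq_bigr => d _; rewrite inE; case: (d \in D) => //=.
  by case: (pi d == _); rewrite ?mulr1 ?mulr0.
rewrite (bigD1 y) //= eqxx big1 ?addr0 => [|z /negPf->]; last by rewrite !mulr0.
have [->|_] := eqVneq (enum_val y) 0; last by rewrite !mulr1 mulrC.
by rewrite g0 eqxx !(mul0r, mulr0).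
Qed.

(** * From the 3-transposition group to the symplectic space *)

Section GroupPart.
Local Open Scope group_scope.

(** Carries all the group theory: size, degree and spectrum depend only on the form, the map and its
    fibres. *)
Lemma three_transposition_pullback (m h : nat) (gT : finGroupType)
    (G : {group gT}) (D : {set gT}) :
  three_transposition_group G D -> type_2h_Sp G D h m ->
  exists g : 'rV['F_2]_(2 * m) -> 'rV['F_2]_(2 * m) -> 'F_2,
  exists pi : gT -> 'rV['F_2]_(2 * m),
  [/\ symplectic_F2 g,
      {in D, forall d, pi d != 0%R},
      forall w, w != 0%R -> #|[set d in D | pi d == w]| = (2 ^ h)%N &
      {in D &, forall d e, adjacent d e = (g (pi d) (pi e) != 0%R)}].
Proof.
move=> [genD _ ordD ordDD] [N [nNG N2 fibD [f fS [phi phi_isom phiD]]]].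
pose g := fun u v => f u v; exists g.
have gS : symplectic_F2 g by apply: psymplectic_F2.
have [gD gC g0 g1] := gS.
have sDG : D \subset G by rewrite -genD subset_gen.
have sGN : G \subset 'N(N) by case/andP: nNG.
have DG d : d \in D -> d \in G by apply: (subsetP sDG).
have DN d : d \in D -> d \in 'N(N) by move/DG; apply: (subsetP sGN).
pose psi d := phi (coset N d).
have phi_inj : 'injm phi by case/isomP: phi_isom.
have GQ x : x \in G -> coset N x \in G / N by apply: mem_quotient.
have psiM x y : x \in G -> y \in G -> psi (x * y) = psi x * psi y.
  by move=> Gx Gy; rewrite /psi morphM ?(subsetP sGN) // morphM ?GQ.
pose is_tv (s : {perm 'rV['F_2]_(2 * m)})
    (v : 'rV['F_2]_(2 * m)) :=
  (v != 0%R) && [forall x, s x == (x + g x v *: v)%R].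
have gDl u v w : g (u + v)%R w = (g u w + g v w)%R by rewrite !(gC _ w) gD.
have addvv (v : 'rV['F_2]_(2 * m)) : (v + v = 0)%R.
  by have := symplectic_F2_addr_eq0 v v gS; rewrite eqxx => /eqP.
have gZ a (u v : 'rV['F_2]_(2 * m)) : g u v = 0%R -> g (a *: u)%R v = 0%R.
  move=> uv; case: (F2P a) => ->; last by rewrite scale1r.
  by rewrite scale0r; apply: (addrI (g 0%R v)); rewrite -gDl !addr0.
have tv_invol (w : 'rV['F_2]_(2 * m)) : involutive (fun x => x + g x w *: w)%R.
  move=> x; rewrite gDl gZ ?g0 // addr0; case: (F2P (g x w)) => ->.
    by rewrite scale0r !addr0.
  by rewrite scale1r -addrA addvv addr0.
have tvE s v : is_tv s v -> forall x, s x = (x + g x v *: v)%R.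
  by case/andP=> _ /forallP sE x; exact: (eqP (sE x)).
(* A transvection determines its vector: where g v x = 1 it moves x by v, and it can only move x by
   0 or w. *)
have tv_inj s v w : is_tv s v -> is_tv s w -> v = w.
  move=> sv sw; have /andP[v0 _] := sv; have [x gvx] := g1 v v0.
  have := tvE _ _ sv x; rewrite (tvE _ _ sw x) => /addrI.
  rewrite (gC x v) gvx scale1r; case: (F2P (g x w)) => ->.
    by rewrite scale0r => v0'; rewrite -v0' eqxx in v0.
  by rewrite scale1r.
have tv_fun s t v : is_tv s v -> is_tv t v -> s = t.
  by move=> sv tv; apply/permP=> x; rewrite (tvE _ _ sv) (tvE _ _ tv).
(* By [piP] the default 0 is never taken on [D]. *)
pose pi d := odflt 0%R [pick v | is_tv (psi d) v]; exists pi.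
have piP d : d \in D -> is_tv (psi d) (pi d).
  move=> Dd; have : psi d \in transvections f.
    rewrite -phiD; apply: mem_morphim; first by rewrite GQ ?DG.
    by rewrite quotientE; apply: mem_morphim => //; apply: DN.
  rewrite inE => /existsP[v sv]; rewrite /pi; case: pickP => [//|/(_ v)].
  by rewrite /is_tv sv.
(* Same vector, same transvection, hence same coset of [N] as [phi] is injective: the fibres are the
   sets counted by [fibD]. *)
have pi_psi d e : d \in D -> e \in D -> (pi d == pi e) = (e \in d *: N).
  move=> Dd De; rewrite -norm_rlcoset ?DN //.
  apply/eqP/(rcoset_kercosetP (DN e De) (DN d Dd)) => [eq_pi|eq_c].
    apply: (injmP phi_inj); rewrite ?GQ ?DG //.
    by apply: (tv_fun (psi e) (psi d) (pi e)); [|rewrite -eq_pi]; exact: piP.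
  by apply: (tv_inj (psi d)); rewrite ?piP // /psi -eq_c; apply: piP.
split=> // [d /piP/andP[] //|w w0|d e Dd De].
- have : w \in [set v | [exists d in D, is_tv (psi d) v]].
    pose s := perm (inv_inj (tv_invol w)).
    have sw : is_tv s w by rewrite /is_tv w0; apply/forallP=> x; rewrite permE.
    have : s \in transvections f.
      by rewrite inE; apply/existsP; exists w; exact: sw.
    rewrite -phiD => /morphimP[c _ /morphimP[d _ Dd ->] sE].
    by rewrite inE; apply/existsP; exists d; rewrite Dd /psi -sE.
  rewrite inE => /existsP[d /andP[Dd dw]].
  have -> : w = pi d by apply: tv_inj dw (piP _ Dd).
  rewrite -(fibD d Dd); apply: eq_card => e; rewrite !inE.
  by case De: (e \in D) => //=; rewrite eq_sym pi_psi.
have Gde : d * e \in G by rewrite groupM ?DG.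
have psi2 : psi ((d * e) ^+ 2) = (psi d * psi e) ^+ 2.
  by rewrite !expgS !expg0 !mulg1 (psiM _ _ Gde Gde) psiM ?DG.
have dv := tvE _ _ (piP d Dd); have ew := tvE _ _ (piP e De).
have [gvw|gvw] := F2P (g (pi d) (pi e)); rewrite gvw.
  (* Value 0: the transvections commute, so (de)^2 lies in [N]. If de had order 3, then de = (de)^4
     would be an element of order 3 in a 2-group. *)
  rewrite eqxx; apply/negbTE/negP => /eqP o3.
  have tv_sq s v : is_tv s v -> s ^+ 2 = 1.
    by move/tvE => sE; apply/permP=> x; rewrite permM perm1 !sE tv_invol.
  have cde : commute (psi d) (psi e).
    apply/permP=> x; rewrite !permM !dv !ew !gDl.
    by rewrite (gZ _ _ (pi e)) ?(gZ _ _ (pi d)) ?(gC (pi e)) // !addr0 addrAC.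
  have N_de2 : (d * e) ^+ 2 \in N.
    rewrite coset_idr ?groupX ?(subsetP sGN) //.
    apply: (injmP phi_inj); rewrite ?GQ ?groupX // morph1 -/(psi _) psi2.
    by rewrite expgMn // (tv_sq _ _ (piP d Dd)) (tv_sq _ _ (piP e De)) mulg1.
  have N_de : d * e \in N.
    have -> : d * e = ((d * e) ^+ 2) ^+ 2.
      by rewrite -expgM (expgS _ 3) -o3 expg_order mulg1.
    by rewrite groupX.
  by have := mem_p_elt N2 N_de; rewrite /p_elt o3.
rewrite oner_eq0 /=; apply/idPn => n3.
have: (psi d * psi e) ^+ 2 = 1.
  rewrite -psi2 (_ : (d * e) ^+ 2 = 1); first by rewrite /psi !morph1.
  apply/eqP; rewrite -order_dvdn; move: n3 (ordDD d e Dd De).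
  by rewrite /adjacent !inE => /negPf->; rewrite orbF => /orP[] /eqP->.
(* Value 1: with v, w the vectors of d, e, the four transvections in turn send v to v, v + w, w, w.
   So v = w, against g v v = 0. *)
move/permP/(_ (pi d)); rewrite perm1 expgS expg1 !permM !dv !ew.
rewrite g0 scale0r addr0 gvw scale1r gDl g0 add0r gC gvw scale1r.
rewrite !(addrAC (pi d) (pi e)) addvv add0r g0 scale0r addr0 => ewd.
by move: gvw; rewrite ewd g0.
Qed.

End GroupPart.

(** * Size, degree and spectrum of the diagram *)

Theorem proposition6p8 (m h : nat) (hm : (2 <= m)%N)
    (gT : finGroupType) (G : {group gT}) (D : {set gT})
    (hGD : three_transposition_group G D) (hT : type_2h_Sp G D h m) :
  #|D| = (2 ^ h * (2 ^ (2 * m) - 1))%N /\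
  diagram_spectrum_star D (2 ^ (2 * m - 1 + h))%N
    (nseq (2 ^ (2 * m - 1) - 2 ^ (m - 1) - 1)%N (2 ^ (m - 1 + h))%N%:R ++
     nseq (2 ^ (2 * m - 1) + 2 ^ (m - 1) - 1)%N (- (2 ^ (m - 1 + h))%N%:R))
    0.
Proof.
have [g [pi [gS pi0 fibc adjE]]] := three_transposition_pullback hGD hT.
have m_gt0 : (0 < m)%N by apply: ltnW.
have cardV : #|{: 'rV['F_2]_(2 * m)}| = (2 ^ (2 * m))%N.
  by rewrite card_mx card_Fp // mul1n.
have half q : (2 * q = 2 ^ (2 * m) -> q = 2 ^ (2 * m - 1))%N.
  move=> E; apply/eqP; rewrite -(eqn_pmul2l (isT : 0 < 2)%N) -expnS E.
  by apply/eqP; congr (_ ^ _)%N; lia.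
have cardD : #|D| = (2 ^ h * (2 ^ (2 * m) - 1))%N.
  have -> : D = [set d in D | pi d != 0].
    by apply/setP=> d; rewrite inE; case: (boolP (d \in D)) => // /pi0->.
  rewrite (card_set_fibers (Q := fun w => w != 0) fibc) -cardV; congr (_ * _)%N.
  by rewrite subn1 -(cardC1 (0 : 'rV['F_2]_(2 * m))); apply: eq_card.
split=> //; split.
  move=> d Dd; have -> : [set e in D | adjacent d e]
      = [set e in D | g (pi d) (pi e) != 0].
    apply/setP=> e; rewrite !inE; case: (boolP (e \in D)) => // De.
    by rewrite adjE.
  rewrite (card_set_fibers (Q := fun w => g (pi d) w != 0) (c := (2 ^ h)%N)).
    rewrite expnD mulnC; congr (_ * _)%N; apply: half.
    by rewrite (card_form_neq0 gS (pi0 d Dd)) cardV.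
  move=> w gw; apply: fibc; apply: contraNneq gw => ->.
  by case: gS => gD _ _ _; apply/eqP/(addrI (g (pi d) 0)); rewrite -gD !addr0.
have c0 : (2 ^ h)%N%:R != 0 :> algC by rewrite pnatr_eq0 -lt0n expn_gt0.
(* The other entries number 1 + (2^(2m) - 2); [le_q] below shows that the subtraction does not
   truncate. *)
exists (#|D|.+1 - 2 ^ (2 * m))%N; rewrite /spectrum_of.
have -> : diagram_adjmx D = pullback_mx D g pi.
  by apply/matrixP=> i j; rewrite !mxE adjE ?enum_valP.
have X0 : ('X ^+ (2 ^ (2 * m)) : {poly algC}) != 0 by rewrite monic_neq0 ?monicXn.
(* After this multiplication both sides carry ['X ^+ #|D|.+1], one factor 'X coming from the
   eigenvalue 0 of the form matrix. *)
apply: (mulfI X0); rewrite -{1}cardV (char_poly_pullback_mx gS pi0 fibc).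
rewrite (char_poly_form_mx gS cardV m_gt0 c0) -!natrM -!expnD.
rewrite !(addnC h) big_cons !big_cat /= !big_nseq !iter_mulr_1.
have le_q : (2 ^ (2 * m) <= #|D|.+1)%N.
  by rewrite cardD -[leqRHS]add1n -leq_subLR leq_pmull // expn_gt0.
rewrite polyC0 subr0 rmorphN opprK.
transitivity (('X : {poly algC}) ^+ #|D|.+1 * ('X - (2 ^ (2 * m - 1 + h))%:R%:P)
  * ('X - (2 ^ (m - 1 + h))%:R%:P) ^+ (2 ^ (2 * m - 1) - 2 ^ (m - 1) - 1)
  * ('X + (2 ^ (m - 1 + h))%:R%:P) ^+ (2 ^ (2 * m - 1) + 2 ^ (m - 1) - 1)).
  by rewrite exprSr !mulrA.
by rewrite -{1}(subnKC le_q) exprD; ring.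
Qed.
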